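(* Let $d>0$, $q\in\mathbb{N}$ with $q\ge 1$, $\lambda>0$, $\mathcal{A}=d\{0,\pm1,\dots,\pm q\}$, let $A\in\mathbb{R}^{m\times n}$ with $m<n$, let $\widetilde{x}\in\mathcal{A}^n$ be a $k$-sparse signal, and let $y=A\widetilde{x}$. Let $$\mathcal{H}(x)=\frac12\|y-Ax\|_2^2+\lambda\sum_{i=1}^n\beta_i(x_i)\,|x_i|-\frac{\lambda}{2}\|x\|_2^2,\qquad x\in[-dq,dq]^n,$$ where $\beta_i(x_i)=\min\{\alpha\in\mathcal{A}:\ |x_i|\le\alpha\}$. If $A$ satisfies the $\ell_2$-robust null space property (RNSP) of order $k$ with parameters $\tau>0$ and $\rho\in\left(0,\frac{\sqrt{1-2q\lambda\tau^2}}{2q^2}\right)$, and $\lambda<\frac{1}{2q\tau^2}$, then $\widetilde{x}$ is the unique global minimum point of $\mathcal{H}$ over $\mathrm{conv}(\mathcal{A}^n)=[-dq,dq]^n$.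
   Context: A vector is $k$-sparse if its support $S$ (set of indices of non-zero components) satisfies $|S|=k$. For $v\in\mathbb{R}^n$ and $S\subseteq\{1,\dots,n\}$, $v_S$ is the restriction of $v$ to the components in $S$, and $S^c$ is the complement of $S$. $\mathrm{conv}$ denotes the convex hull. RNSP: a matrix $A\in\mathbb{R}^{m\times n}$ satisfies the $\ell_2$-robust null space property of order $k$ with parameters $\rho\in(0,1)$, $\tau>0$ if $$\|v_S\|_2\le \frac{\rho}{\sqrt{k}}\|v_{S^c}\|_1+\tau\|Av\|_2$$ for any $v\in\mathbb{R}^n$ and any $S\subset\{1,\dots,n\}$ with $|S|\le k$. *)

(* Defs.v *)
(* MathComp and MathComp-Analysis; R : realType stands for the real line. *)
From mathcomp Require Import all_boot all_order all_algebra.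
From mathcomp Require Import classical_sets reals interval_inference convex.

Set Implicit Arguments.
Unset Strict Implicit.
Unset Printing Implicit Defensive.

Import Order.TTheory GRing.Theory Num.Theory.
Local Open Scope classical_set_scope.
Local Open Scope ring_scope.

Section Defs.
Context {R : realType}.
Implicit Types (m n q k : nat) (d lam rho tau t : R).

Definition norm1 n (v : 'cV[R]_n) : R := \sum_i `|v i 0|.

Definition norm2 n (v : 'cV[R]_n) : R := Num.sqrt (\sum_i v i 0 ^+ 2).

Definition supp n (v : 'cV[R]_n) : {set 'I_n} := [set i | v i 0 != 0]%SET.

Definition sparse k n (v : 'cV[R]_n) : Prop := #|supp v| = k.

(* v_S is kept in R^n, padded with zeros outside S; norms are unaffected. *)
Definition restr n (S : {set 'I_n}) (v : 'cV[R]_n) : 'cV[R]_n :=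
  \col_i (if i \in S then v i 0 else 0).

Definition RNSP m n (A : 'M[R]_(m, n)) k rho tau : Prop :=
  [/\ 0 < rho < 1, 0 < tau &
    forall (v : 'cV[R]_n) (S : {set 'I_n}), (#|S| <= k)%N ->
      norm2 (restr S v) <=
        rho / Num.sqrt k%:R * norm1 (restr (~: S)%SET v) + tau * norm2 (A *m v)].

(* The list of the values d * z for z = -q, ..., q. *)
Definition alphabet d q : seq R :=
  [seq d * (j%:R - q%:R) | j <- iota 0 q.*2.+1].

Definition alphabet_vectors d q n : set 'cV[R]_n :=
  [set x | forall i, x i 0 \in alphabet d q].

Definition box d q n : set 'cV[R]_n :=
  [set x | forall i, - (d * q%:R) <= x i 0 <= d * q%:R].

Definition conv_hull n (X : set 'cV[R]_n) : set 'cV[R]_n :=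
  smallest (@convex_set R 'cV[R]_n) X.

(* min {a in alphabet | |t| <= a}.  The default value d * q of the iterated
   minimum is the largest letter: for |t| <= d * q it belongs to the set being
   minimized, so the default is only visible when |t| > d * q. *)
Definition beta d q t : R :=
  \big[Num.min/d * q%:R]_(a <- alphabet d q | `|t| <= a) a.

(* Total function; only its values on [box d q n] are meaningful. *)
Definition Hfun d q lam m n (A : 'M[R]_(m, n)) (y : 'cV[R]_m) (x : 'cV[R]_n) : R :=
  2^-1 * norm2 (y - A *m x) ^+ 2
  + lam * (\sum_i beta d q (x i 0) * `|x i 0|)
  - lam / 2 * norm2 x ^+ 2.

Definition global_min_point n (f : 'cV[R]_n -> R) (C : set 'cV[R]_n)
    (x : 'cV[R]_n) : Prop :=
  C x /\ forall z, C z -> f x <= f z.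

Definition unique_global_min_point n (f : 'cV[R]_n -> R) (C : set 'cV[R]_n)
    (x : 'cV[R]_n) : Prop :=
  global_min_point f C x /\ forall z, global_min_point f C z -> z = x.

End Defs.

Arguments alphabet_vectors {R} d q n _.
Arguments box {R} d q n _.

(* Main.v *)
Require Import Defs.
From mathcomp Require Import all_boot all_order all_algebra.
From mathcomp Require Import classical_sets reals.
From mathcomp Require Import interval_inference convex ring lra.

Import Order.TTheory GRing.Theory Num.Theory.
Local Open Scope ring_scope.

(** Write [x] for a competitor in the box, [v = x - xt], [S] for the support of
    [xt], [N] for the l1 norm of [v] off [S], [T] for its l2 norm on [S], and
    [w] for the l2 norm of [A v].  The regularizer of H is [lam] times a sum
    over the coordinates of the scalar function
    [penalty t = beta t * |t| - t^2 / 2].  It equals [t^2 / 2] at every letter,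
    is never smaller than that on the box, has a kink at [0], and jumps upwards
    when [|t|] passes a positive letter smaller than [d q].
    Because [y = A xt], the value of H at [x] exceeds the one at [xt] by
    [w^2 / 2 + lam * P], where [P] is the difference of the two total
    penalties; the task is to show that this is positive when [v <> 0].

    Off [S], a coordinate [v_i] gains at least [d |v_i| / 2]
    ([penalty_ge_linear]), for a total of [d N / 2].  On [S], a coordinate can
    lose, and its loss has two bounds: [q v_i^2], because the penalty drops
    only quadratically below the letter [xt_i] ([penalty_deficit]), and
    [(d q)^2 / 2], because the penalty is nonnegative.  Hence both
    [P >= d N / 2 - q T^2] and [P >= d N / 2 - k (d q)^2 / 2].

    If [N > k d q^2], the second bound already makes [P] positive.  Otherwise
    the null space property bounds [T] by [rho N / sqrt k + tau w], and a
    weighted Young inequality with weight [th = 2 q lam tau^2 < 1] splits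
    [T^2] into a part absorbed exactly by [w^2 / 2] and a multiple of
    [rho^2 N^2 / k].  The latter is quadratic in [N], but [N <= k d q^2] turns
    it into a linear term, which the bound on [rho] keeps below [d N / 2].
    This real-number argument is [gap_gt0].

    The convex hull of the alphabet vectors is the box because a point of the
    box is reached from its corners, whose entries are extreme letters, by
    releasing one coordinate at a time ([box_sub_convex]). *)

(** * The alphabet and the scalar penalty *)

Section Alphabet.
Context {R : realType} (d : R) (q : nat).
Hypothesis d_gt0 : 0 < d.

Lemma mem_alphabet_nat i : (i <= q)%N -> d * i%:R \in alphabet d q.
Proof.
move=> iq; apply/mapP; exists (i + q)%N; last by rewrite natrD addrK.
by rewrite mem_iota add0n leq0n ltnS -addnn leq_add2r.
Qed.

Lemma mem_alphabetN a : a \in alphabet d q -> - a \in alphabet d q.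
Proof.
case/mapP=> j; rewrite mem_iota add0n leq0n ltnS /= => jq ->.
apply/mapP; exists (q.*2 - j)%N.
  by rewrite mem_iota add0n leq0n ltnS leq_subr.
by rewrite natrB // -addnn natrD; ring.
Qed.

Lemma norm_alphabet a : a \in alphabet d q ->
  exists2 i, (i <= q)%N & `|a| = d * i%:R.
Proof.
case/mapP=> j; rewrite mem_iota add0n leq0n ltnS /= => jq ->.
case: (leqP j q) => hj.
  exists (q - j)%N; first exact: leq_subr.
  rewrite normrM (gtr0_norm d_gt0) distrC natrB // ger0_norm //.
  by rewrite subr_ge0 ler_nat.
exists (j - q)%N; first by rewrite leq_subLR addnn.
rewrite normrM (gtr0_norm d_gt0) natrB ?(ltnW hj) // ger0_norm //.
by rewrite subr_ge0 ler_nat ltnW.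
Qed.

Lemma norm_alphabet_le a : a \in alphabet d q -> `|a| <= d * q%:R.
Proof.
by case/norm_alphabet=> i iq ->; rewrite (ler_pM2l d_gt0) ler_nat.
Qed.

Lemma beta_ge_norm t : `|t| <= d * q%:R -> `|t| <= beta d q t.
Proof. by move=> ht; apply: le_bigmin. Qed.

Lemma beta_ge_succ i t : (i < q)%N -> d * i%:R < `|t| ->
  d * i.+1%:R <= beta d q t.
Proof.
move=> iq it; rewrite /beta big_seq_cond; apply: le_bigmin.
  by rewrite (ler_pM2l d_gt0) ler_nat.
move=> a /andP[/norm_alphabet[j jq ja] ta].
have a0 : 0 <= a by apply: le_trans ta.
move: ja; rewrite ger0_norm // => ja.
by rewrite ja (ler_pM2l d_gt0) ler_nat -(ltr_nat R) -(ltr_pM2l d_gt0) -ja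
  (lt_le_trans it).
Qed.

Lemma beta_alphabet a : a \in alphabet d q -> beta d q a = `|a|.
Proof.
move=> ha; apply/eqP; rewrite eq_le beta_ge_norm ?norm_alphabet_le // andbT.
have [i iq ai] := norm_alphabet _ ha.
apply: (@bigmin_inf_seq _ _ _ _ _ `|a|) => //.
by rewrite ai mem_alphabet_nat.
Qed.

(** One coordinate of the regularizer of H, with the concave quadratic
    correction included and the weight [lam] divided out. *)
Definition penalty t : R := beta d q t * `|t| - 2^-1 * t ^+ 2.

Lemma penalty_alphabet a : a \in alphabet d q -> penalty a = 2^-1 * a ^+ 2.
Proof.
move=> ha; rewrite /penalty beta_alphabet // -expr2 real_normK ?num_real //.
by lra.
Qed.

Lemma penalty_ge_sqr t : `|t| <= d * q%:R -> 2^-1 * t ^+ 2 <= penalty t.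
Proof.
move=> /beta_ge_norm bt; rewrite /penalty -(real_normK (num_real t)).
have := normr_ge0 t; move: `|t| (beta _ _ _) bt => u b bt u0; nra.
Qed.

(** The gain of a coordinate whose true value is zero: [beta] jumps to at least
    [d] away from zero, and it also dominates [|t|], so that [beta - |t| / 2] is
    at least [d / 2]. *)
Lemma penalty_ge_linear t : (0 < q)%N -> `|t| <= d * q%:R ->
  2^-1 * d * `|t| <= penalty t.
Proof.
move=> q0 ht; rewrite /penalty -(real_normK (num_real t)).
case: (eqVneq t 0) => [->|t0]; first by rewrite normr0; lra.
have bt := beta_ge_norm _ ht.
have : d * 1 <= beta d q t.
  by apply: (beta_ge_succ 0); rewrite ?mulr0 ?normr_gt0.
have := normr_ge0 t; move: `|t| (beta _ _ _) bt => u b bt u0 bd; nra.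
Qed.

(** If [|t|] lies in the cell just below [|a|], then [beta t] is still at least
    [|a|] and the loss is at most [(|a| - |t|)^2 / 2].  Further down, the
    penalty is at least [t^2 / 2], and the loss
    [(|a| - |t|) (|a| + |t|) / 2 <= (|a| - |t|) d q] is quadratic in the
    distance because that distance is at least one step [d]. *)
Lemma penalty_deficit a t : a \in alphabet d q -> `|t| <= d * q%:R ->
  2^-1 * a ^+ 2 - penalty t <= q%:R * (t - a) ^+ 2.
Proof.
move=> ha ht; have sqt := penalty_ge_sqr _ ht.
have aq := norm_alphabet_le _ ha.
have dist : (`|a| - `|t|) ^+ 2 <= (t - a) ^+ 2.
  rewrite -(real_normK (num_real (`|a| - `|t|))) -(real_normK (num_real (t - a))).
  by rewrite ler_pXn2r ?nnegrE // (distrC t a) ler_dist_dist.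
have q0 : 0 <= q%:R :> R by [].
apply: le_trans (ler_wpM2l q0 dist).
rewrite -(real_normK (num_real a)).
case: (leP `|a| `|t|) => [at_|ta].
  apply: (@le_trans _ _ 0); last by rewrite mulr_ge0 ?sqr_ge0.
  move: sqt; rewrite -(real_normK (num_real t)).
  have := normr_ge0 a; move: at_; move: `|a| `|t| (penalty t).
  by move=> u v p uv u0 pv; have : u * u <= v * v; [exact: ler_pM | lra].
have [i iq ai] := norm_alphabet _ ha.
case: i => [|i] in iq ai.
  by move: ta; rewrite ai mulr0 ltNge normr_ge0.
(* Here [|a| = d * i.+1]: either [t] is at least a full step below, or it is
   in the cell that ends at [|a|]. *)
case: (leP `|t| (d * i%:R)) => [ti|it].
  move: sqt; rewrite -(real_normK (num_real t)).
  have gap : d <= `|a| - `|t| by rewrite ai -natr1; lra.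
  have sum : `|a| + `|t| <= d * (2 * q%:R) by lra.
  have := normr_ge0 a; have := normr_ge0 t.
  move: gap sum ta q0; move: `|a| `|t| (penalty t) q%:R.
  move=> u v p Q gap sum vu Q0 v0 u0 pv.
  apply: (@le_trans _ _ (2^-1 * (u - v) * (u + v))); first lra.
  apply: (@le_trans _ _ (2^-1 * (u - v) * (d * (2 * Q)))).
    by rewrite ler_wpM2l //; lra.
  have -> : 2^-1 * (u - v) * (d * (2 * Q)) = Q * ((u - v) * d) by field.
  by rewrite ler_wpM2l // expr2 ler_wpM2l //; lra.
have b_a : `|a| <= beta d q t by rewrite ai; apply: beta_ge_succ.
have q1 : 1 <= q%:R :> R by rewrite ler1n; apply: leq_trans iq.
rewrite /penalty -(real_normK (num_real t)).
apply: (@le_trans _ _ (2^-1 * (`|a| - `|t|) ^+ 2)).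
  have := normr_ge0 t; move: b_a; move: `|a| `|t| (beta _ _ _).
  by move=> u v b ub v0; have := ler_wpM2r v0 ub; lra.
by rewrite ler_wpM2r ?sqr_ge0 //; lra.
Qed.

End Alphabet.

(** * The convex hull of the alphabet vectors *)

Section Hull.
Context {R : realType} (d : R) (q n : nat).
Hypothesis d_gt0 : 0 < d.

Lemma alphabet_vectors_sub_box :
  (alphabet_vectors d q n `<=` box d q n)%classic.
Proof. by move=> x hx i; rewrite -ler_norml norm_alphabet_le. Qed.

Lemma box_convex : @convex_set R 'cV[R]_n (box d q n).
Proof.
move=> x y t; rewrite !inE => hx hy i.
have := hx i; have := hy i; rewrite !mxE.
have t0 : 0 <= t%:num by [].
have t1 : 0 <= 1 - t%:num by rewrite subr_ge0.
rewrite /unstable.onem; move: (x i 0) (y i 0) (d * _) (t%:num) t0 t1 => a b c s s0 s1.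
by move=> /andP[b1 b2] /andP[a1 a2]; apply/andP; split; nra.
Qed.

(** Induction on the number [p] of leading coordinates that may be arbitrary,
    the others being extreme letters: the last free coordinate is written as a
    convex combination of [d * q] and [- (d * q)], which places the point on a
    segment between two points with fewer free coordinates. *)
Lemma box_sub_convex (C : set 'cV[R]_n) : (0 < q)%N ->
  @convex_set R 'cV[R]_n C -> (alphabet_vectors d q n `<=` C)%classic ->
  (box d q n `<=` C)%classic.
Proof.
move=> q0 Ccvx AC x hx.
set M := d * q%:R.
have M0 : 0 < M by rewrite mulr_gt0 ?ltr0n.
suff main p (z : 'cV[R]_n) : box d q n z ->
    (forall i : 'I_n, (p <= i)%N -> z i 0 = M \/ z i 0 = - M) -> C z.
  by apply: (main n) => // i; rewrite leqNgt ltn_ord.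
elim: p z => [|p IH] z hz corner.
  apply: AC => i; have Mq : M \in alphabet d q by apply: mem_alphabet_nat.
  by case: (corner i isT) => ->; rewrite // mem_alphabetN.
case: (ltnP p n) => pn; last first.
  by apply: IH => // i pi; move: (ltn_ord i); rewrite ltnNge (leq_trans pn).
pose j := Ordinal pn.
pose move_to (s : R) : 'cV[R]_n := \col_i (if i == j then s else z i 0).
have C_move s : s = M \/ s = - M -> C (move_to s).
  move=> hs; apply: IH => i.
    rewrite !mxE; case: eqP => // _; rewrite -/M.
    by case: hs => ->; apply/andP; split; lra.
  rewrite mxE; case: (eqVneq i j) => // ij pi; apply: corner.
  rewrite ltn_neqAle pi andbT; apply: contraNneq ij => pi'.
  by apply/eqP/val_inj.
have /andP[zj1 zj2] := hz j; rewrite -/M in zj1 zj2.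
pose t := (z j 0 + M) / (2 * M).
have t0 : 0 <= t by rewrite divr_ge0 //; lra.
have t1 : t <= 1 by rewrite ler_pdivrMr; lra.
have /(_ (Itv01 t0 t1)) := Ccvx (move_to M) (move_to (- M)) _
  (mem_set (C_move M (or_introl erefl))) (mem_set (C_move (- M) (or_intror erefl))).
(* The weight [t] solves [t * M + (1 - t) * - M = z j 0]. *)
rewrite inE; congr (C _); apply/matrixP => i o; rewrite !ord1 !mxE /=.
rewrite /unstable.onem; case: eqP => [->|_]; last by ring.
by rewrite /t; field; rewrite gt_eqF.
Qed.

Lemma conv_hull_alphabet : (0 < q)%N ->
  conv_hull (alphabet_vectors d q n) = box d q n.
Proof.
move=> q0; apply/seteqP; split.
  apply: smallest_sub; first exact: box_convex.
  exact: alphabet_vectors_sub_box.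
by move=> x hx C [Ccvx AC]; apply: (box_sub_convex C).
Qed.

End Hull.

(** * The real-number inequality *)

Section Gap.
Context {R : realType}.
Implicit Types d Q lam tau rho K w T N P : R.

(** The slack is the square of [th * a - (1 - th) * b].  Clearing the
    denominators of [a ^+ 2 / (1 - th) + b ^+ 2 / th] avoids divisions. *)
Lemma young_sqr (th a b : R) : 0 < th -> th < 1 ->
  th * (1 - th) * (a + b) ^+ 2 <= th * a ^+ 2 + (1 - th) * b ^+ 2.
Proof. by move=> h0 h1; have := sqr_ge0 (th * a - (1 - th) * b); nra. Qed.

(** The two lower bounds on [P] complement each other: the one with [K], the
    sparsity, is enough for large [N]; for small [N] the one with [T] is
    combined with the null space inequality.  When [K = 0] the quotient
    [rho / Num.sqrt K] is [0], but then every [N > 0] is large, so that it is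
    only expanded for [K > 0]. *)
Lemma gap_gt0 d Q lam tau rho K w T N P :
  0 < d -> 1 <= Q -> 0 < lam -> 0 < tau -> 0 <= K -> 0 < rho ->
  2 * Q * lam * tau ^+ 2 < 1 ->
  4 * Q ^+ 4 * rho ^+ 2 <= 1 - 2 * Q * lam * tau ^+ 2 ->
  0 <= w -> 0 <= T -> 0 <= N ->
  T <= rho / Num.sqrt K * N + tau * w ->
  2^-1 * d * N - Q * T ^+ 2 <= P ->
  2^-1 * d * N - K * (2^-1 * (d * Q) ^+ 2) <= P ->
  N != 0 \/ T != 0 ->
  0 < 2^-1 * w ^+ 2 + lam * P.
Proof.
move=> d0 Q1 lam0 tau0 K0 rho0 th1 hrho w0 T0 N0 hT P1 P2 NT.
have Q0 : 0 < Q by lra.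
case: (ltP (K * (d * Q ^+ 2)) N) => [bigN|smallN].
  have P0 : 0 < P.
    apply: lt_le_trans P2.
    have -> : 2^-1 * d * N - K * (2^-1 * (d * Q) ^+ 2) =
              2^-1 * d * (N - K * (d * Q ^+ 2)) by field.
    by rewrite pmulr_rgt0 ?subr_gt0 //; lra.
  by have := mulr_gt0 lam0 P0; have := sqr_ge0 w; lra.
apply: (@lt_le_trans _ _ (2^-1 * w ^+ 2 + lam * (2^-1 * d * N - Q * T ^+ 2)));
  last by rewrite lerD2l ler_pM2l.
set th := 2 * Q * lam * tau ^+ 2 in th1 hrho.
have tau20 : 0 < tau ^+ 2 by rewrite exprn_gt0.
(* With [N = 0], the null space inequality reads [T <= tau * w], and [th < 1]
   leaves a positive multiple of [T ^+ 2]. *)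
case: (eqVneq N 0) => [N_0|N_neq0].
  have Tpos : 0 < T by rewrite lt0r T0 andbT; case: NT => //; rewrite N_0 eqxx.
  move: hT; rewrite N_0 mulr0 add0r => hT.
  have T2 : T ^+ 2 <= tau ^+ 2 * w ^+ 2.
    by rewrite -exprMn ler_pXn2r ?nnegrE // mulr_ge0 // ltW.
  have T2pos : 0 < T ^+ 2 by rewrite exprn_gt0.
  rewrite -(pmulr_rgt0 _ tau20).
  have : 0 < (1 - th) * T ^+ 2 by rewrite mulr_gt0 //; lra.
  by rewrite /th; lra.
have Npos : 0 < N by rewrite lt0r N_neq0.
have Kpos : 0 < K.
  rewrite lt0r K0 andbT; apply: contraTneq smallN => ->.
  by rewrite mul0r -ltNge.
have th0 : 0 < th by rewrite /th !mulr_gt0 //; lra.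
set a := rho / Num.sqrt K * N in hT.
have a2 : K * a ^+ 2 = rho ^+ 2 * N ^+ 2.
  by rewrite /a !exprMn exprVn sqr_sqrtr //; field; rewrite gt_eqF.
have a0 : 0 <= a by rewrite /a mulr_ge0 // divr_ge0 ?sqrtr_ge0 // ltW.
have T2 : T ^+ 2 <= (a + tau * w) ^+ 2.
  by rewrite ler_pXn2r ?nnegrE // addr_ge0 // mulr_ge0 // ltW.
(* The smallness of [N] trades one factor [N] of [a ^+ 2] for [K * d * Q ^+ 2]. *)
have a2_le : 4 * Q ^+ 2 * a ^+ 2 <= (1 - th) * (d * N).
  have KQ : 0 < K * Q ^+ 2 by rewrite mulr_gt0 ?exprn_gt0.
  rewrite -(ler_pM2l KQ).
  have -> : K * Q ^+ 2 * (4 * Q ^+ 2 * a ^+ 2) = 4 * Q ^+ 4 * (K * a ^+ 2).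
    by ring.
  rewrite a2 mulrA.
  apply: (@le_trans _ _ ((1 - th) * N ^+ 2)).
    by rewrite ler_wpM2r ?sqr_ge0.
  have -> : K * Q ^+ 2 * ((1 - th) * (d * N)) = (1 - th) * (K * (d * Q ^+ 2) * N).
    by ring.
  by rewrite ler_pM2l ?subr_gt0 // expr2 ler_wpM2r.
have yg := young_sqr th a (tau * w) th0 th1.
have h1 : 0 < th * (1 - th) by rewrite mulr_gt0 // subr_gt0.
have T3 : th * (1 - th) * T ^+ 2 <= th * a ^+ 2 + (1 - th) * (tau * w) ^+ 2.
  by apply: le_trans yg; rewrite ler_pM2l.
(* Dividing [T3] by [tau ^+ 2]: the weight [th] makes the coefficient of
   [w ^+ 2] match the data term. *)
have T4 : 2 * Q * lam * (1 - th) * T ^+ 2 <=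
          2 * Q * lam * a ^+ 2 + (1 - th) * w ^+ 2.
  rewrite -(ler_pM2l tau20).
  have -> : tau ^+ 2 * (2 * Q * lam * (1 - th) * T ^+ 2) =
            th * (1 - th) * T ^+ 2 by rewrite /th; ring.
  have -> : tau ^+ 2 * (2 * Q * lam * a ^+ 2 + (1 - th) * w ^+ 2) =
     th * a ^+ 2 + (1 - th) * (tau * w) ^+ 2 by rewrite /th; ring.
  exact: T3.
have h2 : 0 < 1 - th by rewrite subr_gt0.
have dN : 0 < (1 - th) * (d * N) by rewrite !mulr_gt0.
have a3 : 2 * Q * a ^+ 2 < (1 - th) * (d * N).
  have : 4 * Q * a ^+ 2 <= 4 * Q ^+ 2 * a ^+ 2.
    rewrite ler_wpM2r ?sqr_ge0 // expr2 ler_wpM2l //.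
    by have := ler_wpM2l (ltW Q0) Q1; rewrite mulr1.
  by lra.
rewrite -(pmulr_rgt0 _ h2).
by have := mulr_gt0 lam0 (etrans (subr_gt0 _ _) a3); lra.
Qed.

End Gap.

(** * Comparison of objective values *)

Section Objective.
Context {R : realType}.

Lemma sqr_norm2 n (v : 'cV[R]_n) : norm2 v ^+ 2 = \sum_i v i 0 ^+ 2.
Proof. by rewrite sqr_sqrtr // sumr_ge0 // => i _; rewrite sqr_ge0. Qed.

Lemma sqr_norm2_restr n (S : {set 'I_n}) (v : 'cV[R]_n) :
  norm2 (restr S v) ^+ 2 = \sum_(i in S) v i 0 ^+ 2.
Proof.
rewrite sqr_norm2 [RHS]big_mkcond; apply: eq_bigr => i _; rewrite mxE.
by case: ifP; rewrite ?expr0n.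
Qed.

Lemma norm1_restr n (S : {set 'I_n}) (v : 'cV[R]_n) :
  norm1 (restr S v) = \sum_(i in S) `|v i 0|.
Proof.
rewrite /norm1 [RHS]big_mkcond; apply: eq_bigr => i _; rewrite mxE.
by case: ifP; rewrite ?normr0.
Qed.

Lemma norm2_ge0 n (v : 'cV[R]_n) : 0 <= norm2 v.
Proof. exact: sqrtr_ge0. Qed.

Lemma norm1_ge0 n (v : 'cV[R]_n) : 0 <= norm1 v.
Proof. exact: sumr_ge0. Qed.

Lemma norms_restr_neq0 n (S : {set 'I_n}) (v : 'cV[R]_n) : v != 0 ->
  norm1 (restr (~: S) v) != 0 \/ norm2 (restr S v) != 0.
Proof.
move=> v0; apply/orP; rewrite -negb_and; apply: contraNN v0 => /andP[].
rewrite -(sqrf_eq0 (norm2 _)) sqr_norm2_restr norm1_restr.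
rewrite !psumr_eq0 => [/allP h1 /allP h2|i _|i _]; rewrite ?sqr_ge0 //.
apply/eqP/matrixP => i o; rewrite ord1 mxE; apply/eqP.
have := h1 i (mem_index_enum _); have := h2 i (mem_index_enum _).
by rewrite inE sqrf_eq0 normr_eq0; case: (i \in S).
Qed.

Lemma Hfun_penalty d q lam m n (A : 'M[R]_(m, n)) y x :
  Hfun d q lam A y x =
  2^-1 * norm2 (y - A *m x) ^+ 2 + lam * \sum_i penalty d q (x i 0).
Proof.
rewrite /Hfun sqr_norm2 sqr_norm2 /penalty sumrB -mulr_sumr mulrBr.
by rewrite !mulrA addrA.
Qed.

Section PenaltyGap.
Context {n : nat} (d : R) (q : nat) (a x : 'cV[R]_n).
Hypotheses (d_gt0 : 0 < d) (q_gt0 : (0 < q)%N).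
Hypotheses (ha : alphabet_vectors d q n a) (hx : box d q n x).

Let gap := \sum_i penalty d q (x i 0) - \sum_i penalty d q (a i 0).

(** Any coordinatewise bound [D] on the loss over the support gives a bound on
    the total gap; it is used with the quadratic bound and with the constant
    one. *)
Lemma penalty_gap_ge (D : 'I_n -> R) :
  (forall i, i \in supp a ->
    2^-1 * a i 0 ^+ 2 - penalty d q (x i 0) <= D i) ->
  2^-1 * d * norm1 (restr (~: supp a) (x - a)) - \sum_(i in supp a) D i <= gap.
Proof.
move=> hD; rewrite /gap -sumrB [leRHS](bigID (mem (supp a))) /= [leRHS]addrC.
apply: lerD.
  rewrite norm1_restr mulr_sumr (eq_bigl [predC supp a]) => [|i]; last first.
    by rewrite !inE.
  apply: ler_sum => i /=; rewrite inE negbK => /eqP ai.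
  rewrite (penalty_alphabet _ _ d_gt0 (a i 0)) // !mxE ai subr0 expr0n mulr0 subr0.
  by rewrite penalty_ge_linear // ler_norml.
rewrite -sumrN; apply: ler_sum => i iS.
by rewrite (penalty_alphabet _ _ d_gt0 (a i 0)) // lerNl opprB hD.
Qed.

Lemma penalty_gap_ge_sqr :
  2^-1 * d * norm1 (restr (~: supp a) (x - a))
    - q%:R * norm2 (restr (supp a) (x - a)) ^+ 2 <= gap.
Proof.
rewrite sqr_norm2_restr mulr_sumr; apply: penalty_gap_ge => i _; rewrite !mxE.
by apply: penalty_deficit; rewrite // ler_norml.
Qed.

Lemma penalty_gap_ge_card :
  2^-1 * d * norm1 (restr (~: supp a) (x - a))
    - #|supp a|%:R * (2^-1 * (d * q%:R) ^+ 2) <= gap.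
Proof.
rewrite mulr_natl -sumr_const; apply: penalty_gap_ge => i _.
have xi : `|x i 0| <= d * q%:R by rewrite ler_norml.
have := penalty_ge_sqr _ _ _ xi; have := sqr_ge0 (x i 0).
have : a i 0 ^+ 2 <= (d * q%:R) ^+ 2.
  rewrite -(real_normK (num_real (a i 0))) ler_pXn2r ?nnegrE //.
    exact: norm_alphabet_le.
  by rewrite mulr_ge0 // ltW.
by lra.
Qed.

End PenaltyGap.
End Objective.

Theorem theorem3 (R : realType) (m n k q : nat) (d lam rho tau : R)
    (A : 'M[R]_(m, n)) (xt : 'cV[R]_n) (y : 'cV[R]_m)
    (hd : 0 < d) (hq : (1 <= q)%N) (hlam : 0 < lam) (hmn : (m < n)%N)
    (hxt : alphabet_vectors d q n xt) (hsparse : sparse k xt)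
    (hy : y = A *m xt)
    (htau : 0 < tau)
    (hrho : 0 < rho < Num.sqrt (1 - 2 * q%:R * lam * tau ^+ 2) / (2 * q%:R ^+ 2))
    (hRNSP : RNSP A k rho tau)
    (hlamtau : lam < 1 / (2 * q%:R * tau ^+ 2)) :
  conv_hull (alphabet_vectors d q n) = box d q n /\
  unique_global_min_point (Hfun d q lam A y) (conv_hull (alphabet_vectors d q n)) xt.
Proof.
have hull := @conv_hull_alphabet _ d q n hd hq.
split=> //; rewrite hull.
have box_xt : box d q n xt by apply: alphabet_vectors_sub_box.
(* Strict inequality against every other point gives both minimality and
   uniqueness. *)
suff strict z : box d q n z -> z != xt -> Hfun d q lam A y xt < Hfun d q lam A y z.
  split; first split=> // z hz.
    by case: (eqVneq z xt) => [->//|/(strict z hz)/ltW].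
  move=> z [hz /(_ _ box_xt) zmin]; apply/eqP; apply: contraTT zmin.
  by rewrite -ltNge; apply: strict.
move=> hz zxt.
have [_ _ nsp] := hRNSP.
have Q1 : 1 <= q%:R :> R by rewrite ler1n.
have Q0 : 0 < q%:R :> R by rewrite ltr0n.
have tau20 : 0 < tau ^+ 2 by rewrite exprn_gt0.
have th1 : 2 * q%:R * lam * tau ^+ 2 < 1.
  by move: hlamtau; rewrite ltr_pdivlMr ?mulr_gt0 //; lra.
have [rho0 rho_lt] := andP hrho.
have rho2 : 4 * q%:R ^+ 4 * rho ^+ 2 <= 1 - 2 * q%:R * lam * tau ^+ 2.
  have th2 : 0 <= 1 - 2 * q%:R * lam * tau ^+ 2 by lra.
  move: rho_lt; rewrite ltr_pdivlMr ?mulr_gt0 ?exprn_gt0 // => /ltW rho_le.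
  rewrite -[leRHS]sqr_sqrtr //.
  have -> : 4 * q%:R ^+ 4 * rho ^+ 2 = (rho * (2 * q%:R ^+ 2)) ^+ 2 by ring.
  by rewrite ler_pXn2r ?nnegrE ?sqrtr_ge0 // !mulr_ge0 ?exprn_ge0 // ltW.
have vneq0 : z - xt != 0 by rewrite subr_eq0.
have cardS : #|supp xt| = k := hsparse.
have := nsp (z - xt) (supp xt); rewrite cardS leqnn => /(_ isT) nspv.
have P2 := penalty_gap_ge_card d q xt z hd hq hxt hz.
rewrite cardS in P2.
have := gap_gt0 _ _ _ _ _ _ _ _ _ _ hd Q1 hlam htau (ler0n R k) rho0 th1 rho2
  (norm2_ge0 _ _) (norm2_ge0 _ _) (norm1_ge0 _ _) nspv
  (penalty_gap_ge_sqr d q xt z hd hq hxt hz) P2 (norms_restr_neq0 _ _ _ vneq0).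
rewrite -subr_gt0 !Hfun_penalty hy subrr -mulmxBr.
have -> : norm2 (0 : 'cV[R]_m) ^+ 2 = 0.
  by rewrite sqr_norm2 big1 // => i _; rewrite mxE expr0n.
have -> : norm2 (A *m (xt - z)) ^+ 2 = norm2 (A *m (z - xt)) ^+ 2.
  rewrite -(opprB z) mulmxN !sqr_norm2; apply: eq_bigr => i _.
  by rewrite mxE sqrrN.
by lra.
Qed.
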